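(* Let $d\ge2$ and let $X$ be a continuous random vector in $\mathbb{R}^d$ which is fully supported on $\mathbb{R}^d$ (the support of its distribution is all of $\mathbb{R}^d$). Let $\theta\in\operatorname*{arg\,max}_{x\in\mathbb{R}^d}HD(x\mid X)$ be a point of highest halfspace depth. Let $0<\gamma<1$ and $$M_\gamma=(1-\gamma)\,\inf_{v\in\mathbb{S}^{d-1}}\mathbb{P}\big(v^\top X\ge\|X\|\sqrt{1-\gamma^2}\big),$$ which satisfies $0<M_\gamma<1$, and let $0<\alpha<1$ satisfy $\alpha^2\in\left(1-\frac{M_\gamma}{d+1},\,1\right)$. Then, for every $u\in\mathbb{S}^{d-1}$, $$\|q_X(\alpha u)-\theta\|\ \ge\ \min_{\|v\|=1}\left|Q_{v^\top X}\!\left(1-\frac{1-\alpha^2}{M_\gamma}\right)-v^\top\theta\right|,$$ where $q_X(\alpha u)$ is the geometric quantile of $X$ with index vector $\alpha u$ and, for $0\le\beta<1$, $Q_{v^\top X}(\beta)=\inf\{t\in\mathbb{R}:\mathbb{P}(v^\top X>t)<1-\beta\}$ is the univariate quantile function of the projection $v^\top X$.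
   Context: $\mathbb{S}^{d-1}$ is the Euclidean unit sphere in $\mathbb{R}^d$; $\|\cdot\|$ and $\langle\cdot,\cdot\rangle$ are the Euclidean norm and inner product. ''Continuous'' random vector means that the distribution of $X$ gives zero mass to every affine hyperplane, i.e. every projection $u^\top X$, $u\in\mathbb{S}^{d-1}$, has a continuous distribution function (in particular there are no atoms). Geometric quantile: for an $\mathbb{R}^d$-valued random vector $X$ ($d>1$) whose distribution is not supported on any line, $u\in\mathbb{S}^{d-1}$ and $0\le\alpha<1$, the geometric quantile $q_X(\alpha u)$ is the (existing and unique) minimiser $$q_X(\alpha u)=\operatorname*{arg\,min}_{q\in\mathbb{R}^d}\Big(\mathbb{E}\big[\|X-q\|-\|X\|\big]-\langle\alpha u,q\rangle\Big).$$ Halfspace (Tukey) depth: $HD(x\mid X)=\inf\{\mathbb{P}(X\in H): H \text{ a closed halfspace of } \mathbb{R}^d \text{ containing } x\}$, equivalently $HD(x\mid X)=\inf_{v\in\mathbb{S}^{d-1}}\mathbb{P}(v^\top(X-x)\ge0)$. *)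

(* Defs.v *)
From HB Require Import structures.
From mathcomp Require Import all_boot all_order all_algebra.
From mathcomp Require Import all_classical all_reals all_analysis.

Set Implicit Arguments.
Unset Strict Implicit.
Unset Printing Implicit Defensive.

Import Order.TTheory GRing.Theory Num.Theory.
Import numFieldNormedType.Exports.

Local Open Scope classical_set_scope.
Local Open Scope ring_scope.

(* The norm that MathComp-Analysis puts on matrices is the sup norm; the
   Euclidean structure is therefore given explicitly.  The topology of 'rV[R]_d
   (the product topology) is the Euclidean one. *)
Definition dot {R : realType} {d : nat} (x y : 'rV[R]_d) : R :=
  \sum_(i < d) x 0 i * y 0 i.

Definition enorm {R : realType} {d : nat} (x : 'rV[R]_d) : R :=
  Num.sqrt (dot x x).

Definition usphere {R : realType} {d : nat} : set 'rV[R]_d :=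
  [set v | enorm v = 1].

Definition is_argmin {R : realType} {V : Type} (A : set V) (f : V -> \bar R)
  (x : V) : Prop := A x /\ (forall y, A y -> (f x <= f y)%E).

Definition is_argmax {R : realType} {V : Type} (A : set V) (f : V -> \bar R)
  (x : V) : Prop := A x /\ (forall y, A y -> (f y <= f x)%E).

Section RandomVectors.
Context {disp : measure_display} {T : measurableType disp} {R : realType}.
Variable P : probability T R.

(* Q_Y(beta); extended-real valued, since it may be -oo at beta = 0. *)
Definition quantile (Y : T -> R) (beta : R) : \bar R :=
  ereal_inf [set t%:E | t in
    [set t : R | (P [set w | (t < Y w)%R] < (1 - beta)%:E)%E]].

Context {d : nat}.

(* Borel measurability, stated on the open sets, which generate the Borel
   sigma-algebra of 'rV[R]_d. *)
Definition random_vector (X : T -> 'rV[R]_d) : Prop :=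
  forall U : set 'rV[R]_d, open U -> measurable (X @^-1` U).

Definition lin_proj (v : 'rV[R]_d) (X : T -> 'rV[R]_d) : T -> R :=
  fun w => dot v (X w).

Definition quantile_gap (X : T -> 'rV[R]_d) (theta : 'rV[R]_d) (beta : R)
  (v : 'rV[R]_d) : \bar R :=
  (`| quantile (lin_proj v X) beta - (dot v theta)%:E |)%E.

Definition continuous_law (X : T -> 'rV[R]_d) : Prop :=
  forall (v : 'rV[R]_d) (c : R), usphere v ->
    P (X @^-1` [set x | dot v x = c]) = 0%E.

Definition law_support (X : T -> 'rV[R]_d) : set 'rV[R]_d :=
  [set x | forall U : set 'rV[R]_d, open U -> U x -> (0 < P (X @^-1` U))%E].

Definition closed_halfspace (H : set 'rV[R]_d) : Prop :=
  exists (v : 'rV[R]_d) (c : R), v != 0 /\ H = [set y | c <= dot v y].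

Definition HD (X : T -> 'rV[R]_d) (x : 'rV[R]_d) : \bar R :=
  ereal_inf [set P (X @^-1` H) | H in
    [set H : set 'rV[R]_d | closed_halfspace H /\ H x]].

(* The integrand is bounded (by the norm of q), so the expectation is finite
   with no moment assumption on X. *)
Definition gq_objective (X : T -> 'rV[R]_d) (a q : 'rV[R]_d) : \bar R :=
  ('E_P[(fun w => enorm (X w - q) - enorm (X w))%R] - (dot a q)%:E)%E.

Definition is_geometric_quantile (X : T -> 'rV[R]_d) (a q : 'rV[R]_d) : Prop :=
  is_argmin setT (gq_objective X a) q.

(* The infimum is that of a nonempty set of probabilities for d >= 1, so
   [fine] loses nothing. *)
Definition Mgamma (X : T -> 'rV[R]_d) (gamma : R) : R :=
  (1 - gamma) * fine (ereal_inf
    [set P [set w | enorm (X w) * Num.sqrt (1 - gamma ^+ 2) <= lin_proj v X w]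
    | v in usphere]).

End RandomVectors.

(* Main.v *)
Require Import Defs.
From mathcomp Require Import all_boot all_order all_algebra.
From mathcomp Require Import all_classical all_reals all_analysis.
From mathcomp Require Import ring lra.
Import Order.TTheory GRing.Theory Num.Theory.
Import numFieldNormedType.Exports.
Local Open Scope classical_set_scope.
Local Open Scope ring_scope.

(* Let c = (1 - alpha^2) / M, so that 1 - alpha < c < 1/2, and let q be the
   geometric quantile in direction u.  Moving q to q + t u changes |X - q| by at
   most t, and does not increase it where u.(X - q) > t; comparing the objective
   at q and q + t u therefore gives P(u.X > u.q + t) <= 1 - alpha < c for every
   t > 0, hence Q_{u.X}(1 - c) <= u.q.  Put g(v) = Q_{v.X}(1 - c) - v.theta.  If
   g(u) >= 0, then |g(u)| <= u.(q - theta) <= |q - theta|.  If g(u) < 0, then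
   g(-u) >= 0 because c < 1/2; since g is continuous on the sphere (the law is
   continuous and has full support), it vanishes on an arc from u to -u, and the
   minimum of |g| is 0. *)

(** * Euclidean geometry and topology of ['rV[R]_d] *)

Section Euclid.
Context {R : realType} {d : nat}.
Implicit Types x y z u v w : 'rV[R]_d.

Lemma dotC x y : dot x y = dot y x.
Proof. by apply: eq_bigr => i _; rewrite mulrC. Qed.

Lemma dotDl x y z : dot (x + y) z = dot x z + dot y z.
Proof. by rewrite -big_split; apply: eq_bigr => i _; rewrite /= mxE mulrDl. Qed.

Lemma dotZl (a : R) x y : dot (a *: x) y = a * dot x y.
Proof. by rewrite mulr_sumr; apply: eq_bigr => i _; rewrite mxE mulrA. Qed.

Lemma dotDr x y z : dot z (x + y) = dot z x + dot z y.
Proof. by rewrite !(dotC z) dotDl. Qed.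

Lemma dotZr (a : R) x y : dot x (a *: y) = a * dot x y.
Proof. by rewrite !(dotC x) dotZl. Qed.

Lemma dotNl x y : dot (- x) y = - dot x y.
Proof. by rewrite -scaleN1r dotZl mulN1r. Qed.

Lemma dotNr x y : dot x (- y) = - dot x y.
Proof. by rewrite !(dotC x) dotNl. Qed.

Lemma dot_ge0 x : 0 <= dot x x.
Proof. by apply: sumr_ge0 => i _; rewrite -expr2 sqr_ge0. Qed.

Lemma sqr_coord_le x i : x 0 i ^+ 2 <= dot x x.
Proof.
rewrite /dot (bigD1 i)//= -expr2 lerDl.
by apply: sumr_ge0 => j _; rewrite -expr2 sqr_ge0.
Qed.

Lemma dot_eq0 x : dot x x = 0 -> x = 0.
Proof.
move=> x0; apply/rowP => i; rewrite mxE; apply/eqP.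
by rewrite -sqrf_eq0 eq_le sqr_ge0 -x0 sqr_coord_le.
Qed.

Lemma enorm_ge0 x : 0 <= enorm x.
Proof. exact: sqrtr_ge0. Qed.

Lemma sqr_enorm x : enorm x ^+ 2 = dot x x.
Proof. by rewrite sqr_sqrtr// dot_ge0. Qed.

Lemma enormN x : enorm (- x) = enorm x.
Proof. by rewrite /enorm dotNl dotNr opprK. Qed.

Lemma enormZ (a : R) x : enorm (a *: x) = `|a| * enorm x.
Proof.
by rewrite /enorm dotZl dotZr mulrA -expr2 sqrtrM ?sqr_ge0// sqrtr_sqr.
Qed.

Lemma enorm_eq0 x : enorm x = 0 -> x = 0.
Proof. by move=> x0; apply: dot_eq0; rewrite -sqr_enorm x0 expr0n. Qed.

Lemma enorm0 : enorm (0 : 'rV[R]_d) = 0.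
Proof. by rewrite -(scale0r 0) enormZ normr0 mul0r. Qed.

Lemma usphere_dot v : usphere v -> dot v v = 1.
Proof. by rewrite /usphere/= -sqr_enorm => ->; rewrite expr1n. Qed.

Lemma usphere_neq0 v : usphere v -> v != 0.
Proof.
move=> sv; apply/eqP => v0; move: sv; rewrite /usphere/= v0 enorm0 => /eqP.
by rewrite eq_sym oner_eq0.
Qed.

Lemma usphere_normalize x : x != 0 -> usphere ((enorm x)^-1 *: x).
Proof.
move=> x0; rewrite /usphere/= enormZ ger0_norm ?invr_ge0 ?enorm_ge0// mulVf//.
by apply: contra x0 => /eqP /enorm_eq0 ->.
Qed.

(** Expanding the squared norm of |y| x - |x| y, which is nonnegative, gives |x| |y| (x.y) <= |x|^2
    |y|^2. The zero vectors are treated apart so that the factor |x| |y| can be cancelled. *)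
Lemma cauchy_schwarz x y : dot x y <= enorm x * enorm y.
Proof.
have [x0|x0] := eqVneq (enorm x) 0.
  by rewrite x0 mul0r (enorm_eq0 x x0) -(scale0r 0) dotZl mul0r.
have [y0|y0] := eqVneq (enorm y) 0.
  by rewrite y0 mulr0 (enorm_eq0 y y0) -(scale0r 0) dotZr mul0r.
have xy0 : 0 < enorm x * enorm y.
  by rewrite mulr_gt0// lt_def ?x0 ?y0 enorm_ge0.
have := dot_ge0 (enorm y *: x - enorm x *: y).
rewrite dotDl !dotDr !dotNl !dotNr !dotZl !dotZr (dotC y x) -!sqr_enorm => h.
by rewrite -(ler_pM2l xy0); nra.
Qed.

Lemma normr_dot_le x y : `|dot x y| <= enorm x * enorm y.
Proof.
by rewrite ler_norml cauchy_schwarz andbT lerNl -dotNl -(enormN x) cauchy_schwarz.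
Qed.

Lemma enormD x y : enorm (x + y) <= enorm x + enorm y.
Proof.
rewrite -ler_sqr ?nnegrE ?addr_ge0 ?enorm_ge0//.
rewrite sqr_enorm dotDl !dotDr (dotC y x) -!sqr_enorm.
have := cauchy_schwarz x y; nra.
Qed.

Lemma continuous_dot (f g : 'rV[R]_d -> 'rV[R]_d) :
  continuous f -> continuous g -> continuous (fun x => dot (f x) (g x)).
Proof.
move=> cf cg.
apply: continuous_big => [|i _ x]; first exact: add_continuous.
have coord (h : 'rV[R]_d -> 'rV[R]_d) : continuous h -> {for x, continuous (fun x => h x 0 i)}.
  move=> ch; apply: (@continuous_comp _ _ _ h (fun M : 'rV[R]_d => M 0 i)).
    exact: ch.
  exact: coord_continuous.
exact: (cvgM (coord f cf) (coord g cg)).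
Qed.

Lemma continuous_dotl v : continuous (dot v).
Proof.
by apply: (continuous_dot (fun=> v) id) => x; [exact: cst_continuous|move=> ?].
Qed.

Lemma continuous_enorm : continuous (@enorm R d).
Proof.
move=> x; apply: continuous_comp; last exact: sqrt_continuous.
by apply: (continuous_dot id id) => {}x ?.
Qed.

Lemma continuous_enormB y : continuous (fun x => enorm (x - y)).
Proof.
move=> x; have cB : {for x, continuous (fun z => z - y)}.
  apply: (@continuousB R ('rV[R]_d : normedModType R) ('rV[R]_d : topologicalType) id (cst y)).
    by move=> ?.
  exact: cst_continuous.
by apply: (continuous_comp cB); exact: continuous_enorm.
Qed.

Lemma nbhs_enorm_lt x e : 0 < e -> \forall y \near x, enorm (y - x) < e.
Proof.
move=> e0.
by have /cvgr_lt := continuous_enormB x x; apply; rewrite subrr enorm0.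
Qed.

(** The sphere is the preimage of a point under a continuous map, hence closed, and it lies in the
    compact box [-1, 1]^d because each squared coordinate is at most v.v = 1. *)
Lemma compact_usphere : compact (@usphere R d).
Proof.
have cbox : compact [set v : 'rV[R]_d | forall i, v ord0 i \in `[(-1 : R), 1]].
  apply: (@rV_compact _ _ (fun=> `[(-1 : R), 1]%classic)).
  by move=> _; exact: segment_compact.
have cS : closed (@usphere R d).
  have /continuous_closedP h := continuous_enorm.
  have c1 : closed [set x : R | x = 1] by exact: closed_eq.
  by have := h _ c1; apply.
apply: (subclosed_compact cS cbox) => v /usphere_dot v1 i.
rewrite in_itv/= -ler_norml -(@ler_pXn2r _ 2)// ?nnegrE// expr1n real_normK ?num_real//.
by rewrite -v1 sqr_coord_le.
Qed.

Lemma exists_orthonormal u : (2 <= d)%N -> usphere u ->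
  exists2 w, usphere w & dot u w = 0.
Proof.
move=> d2 su.
have [i ui] : exists i, u 0 i != 0.
  apply/existsP; apply: contraT; rewrite negb_exists => /forallP u0.
  case/negP: (usphere_neq0 u su).
  by apply/eqP/rowP => i; rewrite mxE; apply/eqP; rewrite -[_ == _]negbK u0.
have [j ij] : exists j, j != i.
  apply/existsP; apply: contraT; rewrite negb_exists => /forallP h.
  have := d2; rewrite -[d]card_ord (cardD1 i) inE/=.
  by rewrite eq_card0// => j; rewrite !inE andbT; apply/negbTE.
(* A quarter turn in the plane of coordinates i and j: u.w = u_j u_i - u_i u_j = 0, and the j-th
   entry -u_i makes [w] nonzero. *)
pose w := u 0 j *: delta_mx 0 i - u 0 i *: delta_mx 0 j : 'rV[R]_d.
have dE k : dot u (delta_mx 0 k) = u 0 k.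
  rewrite /dot (bigD1 k)//= big1 ?mxE ?eqxx ?mulr1 ?addr0// => l lk.
  by rewrite mxE (negbTE lk) andbF mulr0.
exists ((enorm w)^-1 *: w).
  apply: usphere_normalize; apply/eqP => /rowP/(_ j).
  rewrite !mxE eqxx (negbTE ij) andbF !eqxx/= mulr0 mulr1 sub0r => /eqP.
  by rewrite oppr_eq0 (negbTE ui).
by rewrite dotZr dotDr dotNr !dotZr !dE mulrC (mulrC (u 0 j)) subrr mul0r.
Qed.

End Euclid.

(** * Continuity of measure along monotone events, and a comparison of expectations *)

Section Probability.
Context {disp : measure_display} {T : measurableType disp} {R : realType}.
Variable P : probability T R.

Lemma le_probability (A B : set T) :
  measurable A -> measurable B -> A `<=` B -> (P A <= P B)%E.
Proof. by move=> mA mB AB; apply: le_measure; rewrite ?inE. Qed.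

(** Continuity from above: if every [F n] had probability at least [c], so would the intersection,
    and then [B]. It turns a strict bound in the limit into one at a finite index. *)
Lemma nonincreasing_probability_lt (F : (set T)^nat) (B : set T) (c : \bar R) :
  (forall n, measurable (F n)) -> nonincreasing_seq F -> measurable B ->
  \bigcap_n F n `<=` B -> (P B < c)%E -> exists n, (P (F n) < c)%E.
Proof.
move=> mF Fn mB FB; apply: contraPP => /forallNP h; apply/negP; rewrite -leNgt.
have mcap : measurable (\bigcap_n F n) by exact: bigcapT_measurable.
apply: (le_trans _ (le_probability _ _ mcap mB FB)).
apply: (cvge_to_ge (nonincreasing_cvg_mu _ mF mcap Fn)).
  by rewrite (le_lt_trans (probability_le1 _ _))// ltry.
by apply: nearW => n; rewrite leNgt; apply/negP/h.
Qed.

Lemma nondecreasing_probability_gt (F : (set T)^nat) (B : set T) (c : \bar R) :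
  (forall n, measurable (F n)) -> nondecreasing_seq F -> measurable B ->
  B `<=` \bigcup_n F n -> (c < P B)%E -> exists n, (c < P (F n))%E.
Proof.
move=> mF Fn mB FB; apply: contraPP => /forallNP h; apply/negP; rewrite -leNgt.
have mcup : measurable (\bigcup_n F n) by exact: bigcupT_measurable.
apply: (le_trans (le_probability _ _ mB mcup FB)).
apply: (cvge_to_le (nondecreasing_cvg_mu mF mcup Fn)).
by apply: nearW => n; rewrite leNgt; apply/negP/h.
Qed.

(** The two pointwise bounds combine into g <= f + t 1_(~A), which is then integrated. *)
Lemma expectation_sub_le (f g : T -> R) :
  f \in Lfun P 1 -> g \in Lfun P 1 -> forall (A : set T) (t : R),
  measurable A -> (forall w, g w <= f w + t) -> (forall w, A w -> g w <= f w) ->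
  ('E_P[g] <= 'E_P[f] + t%:E * (1 - P A))%E.
Proof.
move=> /Lfun1_integrable intf /Lfun1_integrable intg A t mA gt gA.
have mAC : measurable (~` A) by exact: measurableC.
have intA := integrable_indic P mAC.
rewrite unlock -probability_setC// -(setIT (~` A)) -integral_indic//.
rewrite -integralZl// -integralD//; last exact: integrableZl.
apply: le_integral => //.
  by apply: integrableD => //; exact: integrableZl.
move=> w _; rewrite lee_fin indicE.
have [Aw|Aw] := pselect (A w).
  by rewrite memNset ?mulr0 ?addr0; [exact: gA|move=> /(_ Aw)].
by rewrite mem_set// mulr1.
Qed.

End Probability.

(** * Measurability of events defined by X, survival functions of projections, and quantiles *)

Section Law.
Context {disp : measure_display} {T : measurableType disp} {R : realType}.
Variable P : probability T R.
Context {d : nat}.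
Variable X : T -> 'rV[R]_d.
Hypothesis Xrv : random_vector X.

Lemma measurable_lt_rv (h : 'rV[R]_d -> R) (s : R) :
  continuous h -> measurable [set w | s < h (X w)].
Proof.
by move/continuousP => ch; apply: (Xrv (h @^-1` [set x | s < x])); exact/ch/open_gt.
Qed.

Lemma measurable_ge_rv (h : 'rV[R]_d -> R) (s : R) :
  continuous h -> measurable [set w | s <= h (X w)].
Proof.
move/continuousP => ch; rewrite (_ : mkset _ = ~` (X @^-1` (h @^-1` [set x | x < s]))).
  by apply/measurableC/Xrv/ch/open_lt.
by apply/seteqP; split=> w /=; rewrite leNgt => /negP.
Qed.

Lemma measurable_fun_rv (h : 'rV[R]_d -> R) :
  continuous h -> measurable_fun setT (h \o X).
Proof.
move=> ch mT; apply: (measurability _ (measurable_realfun.RGenOInfty.measurableE R)) => //.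
move=> /= _ [_ [x ->] <-]; rewrite setTI.
rewrite (_ : _ @^-1` _ = [set w | x < h (X w)]); first exact: measurable_lt_rv.
by apply/seteqP; split=> w /=; rewrite in_itv/= andbT.
Qed.

Lemma continuous_dotD_enorm (v : 'rV[R]_d) (a : R) :
  continuous (fun x => dot v x + a * enorm x).
Proof.
move=> x.
exact: (cvgD (continuous_dotl v x) (cvgM (@cst_continuous _ _ a x) (continuous_enorm x))).
Qed.

Lemma measurable_lin_proj_gt (v : 'rV[R]_d) (s : R) :
  measurable [set w | s < lin_proj v X w].
Proof. exact: (measurable_lt_rv _ _ (continuous_dotl v)). Qed.

Lemma measurable_lin_proj_ge (v : 'rV[R]_d) (s : R) :
  measurable [set w | s <= lin_proj v X w].
Proof. exact: (measurable_ge_rv _ _ (continuous_dotl v)). Qed.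

Lemma measurable_cone (v : 'rV[R]_d) (r : R) :
  measurable [set w | enorm (X w) * r <= lin_proj v X w].
Proof.
rewrite (_ : mkset _ = [set w | 0 <= dot v (X w) + (- r) * enorm (X w)]).
  exact: (measurable_ge_rv _ _ (continuous_dotD_enorm v _)).
by apply/seteqP; split=> w /=; rewrite mulNr subr_ge0 mulrC.
Qed.

(** By Cauchy-Schwarz the error is at most |v - v0| |X|. X may be unbounded, so the neighbourhood
    can be uniform in [w] only for an error proportional to |X|. *)
Lemma near_lin_proj (v0 : 'rV[R]_d) (a : R) : 0 < a ->
  \forall v \near v0, forall w,
    `|lin_proj v X w - lin_proj v0 X w| <= a * enorm (X w).
Proof.
move=> a0; near=> v => w; rewrite /lin_proj -dotNl -dotDl.
apply: (le_trans (normr_dot_le _ _)); rewrite ler_wpM2r ?enorm_ge0//.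
by apply: ltW; near: v; exact: nbhs_enorm_lt.
Unshelve. all: by end_near. Qed.

(* As v -> v0, the events [s < v.X] are eventually squeezed between the
   monotone events [s < v0.X - |X|/(n+1)] and [s < v0.X + |X|/(n+1)]. *)
Lemma near_survival_lt (v0 : 'rV[R]_d) (s : R) (c : \bar R) :
  (P [set w | (s <= lin_proj v0 X w)%R] < c)%E ->
  \forall v \near v0, (P [set w | (s < lin_proj v X w)%R] < c)%E.
Proof.
move=> Pc.
pose F n := [set w | s < dot v0 (X w) + n.+1%:R^-1 * enorm (X w)].
have mF n : measurable (F n) by exact: (measurable_lt_rv _ _ (continuous_dotD_enorm v0 _)).
have [n Fnc] : exists n, (P (F n) < c)%E.
  apply: (nonincreasing_probability_lt P F _ c mF _ (measurable_lin_proj_ge v0 s) _ Pc).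
    move=> m n mn; apply/subsetPset => w /=; move/lt_le_trans; apply.
    by rewrite lerD2l ler_wpM2r ?enorm_ge0// lef_pV2 ?posrE// ler_nat.
  move=> w Fw /=; rewrite leNgt; apply/negP => ls.
  pose y := s - lin_proj v0 X w.
  have y0 : 0 < y by rewrite subr_gt0.
  have := Fw (Num.truncn (enorm (X w) / y)) I; rewrite /F/= -ltrBlDl ltNge => /negP; apply.
  rewrite mulrC ler_pdivrMr// mulrC -ler_pdivrMr//.
  exact/ltW/truncnS_gt.
have := near_lin_proj v0 n.+1%:R^-1 ltac:(by rewrite invr_gt0).
apply: filterS => v vv0; apply: le_lt_trans Fnc; apply: le_probability => //.
  exact: measurable_lin_proj_gt.
move=> w /= sw; apply: (lt_le_trans sw); rewrite -lerBlDl.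
exact: le_trans (ler_norm _) (vv0 w).
Qed.

(** Lower half of the squeeze. The inner events increase to exactly [s < v0.X], so the inequality
    stays strict here, whereas the outer events of [near_survival_lt] decrease to [s <= v0.X]. *)
Lemma near_survival_gt (v0 : 'rV[R]_d) (s : R) (c : \bar R) :
  (c < P [set w | (s < lin_proj v0 X w)%R])%E ->
  \forall v \near v0, (c < P [set w | (s < lin_proj v X w)%R])%E.
Proof.
move=> Pc.
pose F n := [set w | s < dot v0 (X w) + (- n.+1%:R^-1) * enorm (X w)].
have mF n : measurable (F n) by exact: (measurable_lt_rv _ _ (continuous_dotD_enorm v0 _)).
have [n Fnc] : exists n, (c < P (F n))%E.
  apply: (nondecreasing_probability_gt P F _ c mF _ (measurable_lin_proj_gt v0 s) _ Pc).
    move=> m n mn; apply/subsetPset => w /=; move/lt_le_trans; apply.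
    by rewrite lerD2l ler_wpM2r ?enorm_ge0// lerN2 lef_pV2 ?posrE// ler_nat.
  move=> w /= ls.
  pose y := lin_proj v0 X w - s.
  have y0 : 0 < y by rewrite subr_gt0.
  (* This index n satisfies n + 1 > |X| / y, that is |X| / (n + 1) < y. *)
  exists (Num.truncn (enorm (X w) / y)) => //; rewrite /F/= mulNr ltrBrDl -ltrBrDr.
  rewrite -/(lin_proj v0 X w) -/y mulrC ltr_pdivrMr// mulrC -ltr_pdivrMr//.
  exact: truncnS_gt.
have := near_lin_proj v0 n.+1%:R^-1 ltac:(by rewrite invr_gt0).
apply: filterS => v vv0; apply: (lt_le_trans Fnc); apply: le_probability => //.
  exact: measurable_lin_proj_gt.
move=> w /= sw; apply: (lt_le_trans sw).
rewrite mulNr lerBlDr -lerBlDl -/(lin_proj v0 X w).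
by apply: le_trans (vv0 w); rewrite distrC ler_norm.
Qed.

Lemma quantile_le (v : 'rV[R]_d) (b t : R) :
  (P [set w | (t < lin_proj v X w)%R] < (1 - b)%:E)%E ->
  (quantile P (lin_proj v X) b <= t%:E)%E.
Proof. by move=> h; apply: ereal_inf_lbound; exists t. Qed.

Lemma quantile_ge (v : 'rV[R]_d) (b t : R) :
  ((1 - b)%:E <= P [set w | (t < lin_proj v X w)%R])%E ->
  (t%:E <= quantile P (lin_proj v X) b)%E.
Proof.
move=> h; apply: le_ereal_inf_tmp => _ [s /= sb <-]; rewrite lee_fin leNgt.
apply/negP => st; move: sb; rewrite ltNge => /negP; apply.
apply: (le_trans h); apply: le_probability => [||w /=]; try exact: measurable_lin_proj_gt.
exact: lt_trans.
Qed.

(** The survival function tends to 0 at +oo, so it drops below 1 - b > 0 and bounds the quantile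
    above; it tends to 1 at -oo, so it exceeds 1 - b < 1 and bounds the quantile below. *)
Lemma quantile_fin_num (v : 'rV[R]_d) (b : R) : 0 < b < 1 ->
  quantile P (lin_proj v X) b \is a fin_num.
Proof.
move=> /andP[b0 b1].
have [n Pn] : exists n, (P [set w | (n%:R < lin_proj v X w)%R] < (1 - b)%:E)%E.
  apply: (nonincreasing_probability_lt P (fun n => [set w | n%:R < lin_proj v X w]) set0) => //.
  - by move=> n; exact: measurable_lin_proj_gt.
  - move=> m n mn; apply/subsetPset => w /=; apply: le_lt_trans.
    by rewrite ler_nat.
  - move=> w /(_ (Num.truncn (lin_proj v X w)).+1 I) /=; rewrite ltNge => /negP; apply.
    exact/ltW/truncnS_gt.
  - by rewrite measure0 lte_fin subr_gt0.
have [m Pm] : exists n, ((1 - b)%:E < P [set w | (- n%:R < lin_proj v X w)%R])%E.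
  apply: (nondecreasing_probability_gt P (fun n => [set w | - n%:R < lin_proj v X w]) setT) => //.
  - by move=> k; exact: measurable_lin_proj_gt.
  - move=> m k mk; apply/subsetPset => w /=; apply: le_lt_trans.
    by rewrite lerN2 ler_nat.
  - move=> w _; exists (Num.truncn (- lin_proj v X w)).+1 => //=.
    by rewrite ltrNl; exact: truncnS_gt.
  - by rewrite probability_setT lte_fin ltrBlDr ltrDl.
rewrite fin_numElt (lt_le_trans (ltNyr _) (quantile_ge _ _ _ (ltW Pm)))/=.
exact: (le_lt_trans (quantile_le _ _ _ Pn) (ltry _)).
Qed.

End Law.

(** * The tail bound at a geometric quantile, then continuity of quantiles and cone bounds from full
    support *)

Section FullSupport.
Context {disp : measure_display} {T : measurableType disp} {R : realType}.
Variable P : probability T R.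
Context {d : nat}.
Variable X : T -> 'rV[R]_d.
Hypothesis Xrv : random_vector X.

Lemma survival_geometric_quantile_le (u q : 'rV[R]_d) (alpha t : R) :
  usphere u -> is_geometric_quantile P X (alpha *: u) q -> 0 < t ->
  (P [set w | (dot u q + t < lin_proj u X w)%R] <= (1 - alpha)%:E)%E.
Proof.
move=> su [_ /(_ (q + t *: u) I)] hq t0; move: hq; rewrite /gq_objective.
set A := mkset _.
have mA : measurable A by exact: measurable_lin_proj_gt.
(* By the triangle inequality the integrand is bounded by |y|, hence integrable whatever the moments
   of X. *)
have intL (y : 'rV[R]_d) : (fun w => enorm (X w - y) - enorm (X w)) \in Lfun P 1.
  rewrite inE/=; apply/Lfun1_integrable.
  apply: measurable_bounded_integrable => //.
  - by rewrite (le_lt_trans (probability_le1 _ _))// ltry.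
  - apply: (measurable_fun_rv X Xrv (fun x => enorm (x - y) - enorm x)) => x.
    exact: (cvgB (continuous_enormB y x) (continuous_enorm x)).
  - exists (enorm y); split=> [|r /ltW yr w _]; first exact: num_real.
    apply: le_trans yr; rewrite ler_norml.
    have := enormD (X w) (- y); have := enormD (X w - y) y; rewrite subrK enormN.
    by lra.
have := expectation_sub_le P _ _ (intL q) (intL (q + t *: u)) A t mA.
have st w : X w - (q + t *: u) = (X w - q) - t *: u by rewrite opprD addrA.
have shift w : enorm (X w - (q + t *: u)) - enorm (X w) <= enorm (X w - q) - enorm (X w) + t.
  have := enormD (X w - q) (- (t *: u)).
  by rewrite -st enormN enormZ su mulr1 gtr0_norm//; lra.
move=> /(_ shift) h.
move: h (expectation_fin_num (intL q)) (expectation_fin_num (intL (q + t *: u))).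
case: ('E_P[_])%E => // e2; case: ('E_P[_])%E => // e1 h _ _.
have : P A \is a fin_num by exact: fin_num_measure.
move: h; case: (P A) => // p h _.
rewrite -!EFinB !lee_fin dotDr !dotZr !dotZl (usphere_dot _ su) => h2.
(* On [A] the norm does not grow: |X - q - t u|^2 - |X - q|^2 = t^2 - 2 t u.(X - q), which is
   negative once u.(X - q) > t. *)
have {}h : e2 <= e1 + t * (1 - p).
  apply: h => w; rewrite /A/= => Aw; rewrite lerD2r st.
  rewrite -ler_sqr ?nnegrE ?enorm_ge0// !sqr_enorm.
  rewrite !(dotDl, dotDr, dotNl, dotNr, dotZl, dotZr) (usphere_dot _ su).
  rewrite (dotC q u) (dotC (X w) u).
  rewrite /lin_proj in Aw; nra.
(* Minimality at [q] gives alpha t <= e2 - e1, and the right side is at most t (1 - p). *)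
suff : t * (p - (1 - alpha)) <= 0 by rewrite pmulr_rle0// subr_le0.
lra.
Qed.

Hypothesis Xsupp : law_support P X = setT.

Lemma probability_open_gt0 (U : set 'rV[R]_d) x :
  open U -> U x -> (0 < P (X @^-1` U))%E.
Proof.
move=> oU Ux; have : law_support P X x by rewrite Xsupp.
exact.
Qed.

(** The two events differ at least by the open slab s < v.x < t, which contains the point ((s + t) /
    2) v and so has positive mass. *)
Lemma survival_strict (v : 'rV[R]_d) (s t : R) : usphere v -> s < t ->
  (P [set w | (t < lin_proj v X w)%R] < P [set w | (s < lin_proj v X w)%R])%E.
Proof.
move=> sv st.
have cv := continuous_dotl v.
pose U := [set x | s < dot v x] `&` [set x | dot v x < t].
have oU : open U.
  apply: openI.
    by have /continuousP h := cv; apply: (h [set x | s < x]); exact: open_gt.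
  by have /continuousP h := cv; apply: (h [set x | x < t]); exact: open_lt.
have Umid : U (((s + t) / 2) *: v).
  by rewrite /U/= dotZr (usphere_dot _ sv) mulr1; split; lra.
have PU := probability_open_gt0 U _ oU Umid.
have mU : measurable (X @^-1` U) by exact: Xrv.
have mt : measurable [set w | t < lin_proj v X w] by exact: measurable_lin_proj_gt.
have Uft := fin_num_measure P _ mt.
apply: (@lt_le_trans _ _ (P ([set w | t < lin_proj v X w] `|` X @^-1` U))).
  rewrite measureU//; first by rewrite lteDl.
  apply/seteqP; split=> // w [/= tw [_]]; rewrite /lin_proj in tw *; move=> wt.
  by have := lt_trans tw wt; rewrite ltxx.
apply: le_probability; [exact: measurableU|exact: measurable_lin_proj_gt|].
by move=> w [/= tw|[/= ]//]; exact: lt_trans tw.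
Qed.

(** With [a] the quantile at [v0], the survival function is strictly below 1 - b at a + e and
    strictly above it at a - e. Both strict inequalities persist for v near v0 and trap the quantile
    in [a - e, a + e]. *)
Lemma near_quantile (b : R) (v0 : 'rV[R]_d) (e : R) :
  continuous_law P X -> 0 < b < 1 -> usphere v0 -> 0 < e ->
  \forall v \near v0, usphere v ->
    `|fine (quantile P (lin_proj v X) b) - fine (quantile P (lin_proj v0 X) b)| <= e.
Proof.
move=> Xcont b01 sv0 e0.
have fq v : quantile P (lin_proj v X) b = (fine (quantile P (lin_proj v X) b))%:E.
  by rewrite fineK// quantile_fin_num.
set a := fine (quantile P (lin_proj v0 X) b).
have up : (P [set w | (a + e <= lin_proj v0 X w)%R] < (1 - b)%:E)%E.
  have mU : measurable [set w | a + e < lin_proj v0 X w] by exact: measurable_lin_proj_gt.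
  (* The hyperplane v0.x = a + e is null, so the closed and open tails have the same probability. *)
  apply: (@le_lt_trans _ _ (P [set w | (a + e < lin_proj v0 X w)%R])).
    have m0 : measurable (X @^-1` [set x | dot v0 x = a + e]).
      have mge : measurable [set w | a + e <= lin_proj v0 X w] by exact: measurable_lin_proj_ge.
      rewrite (_ : _ @^-1` _ = [set w | a + e <= lin_proj v0 X w] `\`
          [set w | a + e < lin_proj v0 X w]).
        exact: measurableD.
      apply/seteqP; split=> w /=; rewrite /lin_proj.
        by move=> ->; split; rewrite ?ltxx.
      by move=> [h1 /negP]; rewrite -leNgt => h2; apply/eqP; rewrite eq_le h1 h2.
    rewrite -[leRHS]adde0 -(Xcont v0 (a + e) sv0) -measureU//.
      apply: le_probability; [exact: measurable_lin_proj_ge|exact: measurableU|].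
      move=> w /=; rewrite le_eqVlt => /orP[/eqP h|h]; [right|left] => //.
    by apply/seteqP; split=> // w [/= ]; rewrite /lin_proj => + h; rewrite h ltxx.
  have : (quantile P (lin_proj v0 X) b < (a + e)%:E)%E by rewrite fq lte_fin ltrDl.
  move=> /ereal_inf_lt [_ [t /= Pt <-]]; rewrite lte_fin => ta.
  apply: le_lt_trans Pt; apply: le_probability => [||w /=]; try exact: measurable_lin_proj_gt.
  exact: lt_trans.
have lo : ((1 - b)%:E < P [set w | (a - e < lin_proj v0 X w)%R])%E.
  (* At a - e / 2 the definition of the quantile gives only a weak inequality; moving on to a - e
     makes it strict by full support. *)
  apply: (@le_lt_trans _ _ (P [set w | (a - e / 2 < lin_proj v0 X w)%R])); last first.
    by apply: survival_strict => //; lra.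
  rewrite leNgt; apply/negP => /quantile_le; rewrite fq lee_fin -/a; lra.
have := near_survival_gt P X Xrv _ _ _ lo.
have := near_survival_lt P X Xrv _ _ _ up.
apply: filterS2 => v hup hlo sv; rewrite ler_distl.
have := quantile_le P X _ _ _ hup; have := quantile_ge P X Xrv _ _ _ (ltW hlo).
by rewrite fq !lee_fin => -> ->.
Qed.

(** Near each direction v0, a single slightly narrower cone around v0 lies inside all the cones in
    question, and its mass is a local lower bound. Compactness of the sphere makes the bound
    uniform. *)
Lemma cone_probability_bound (s : R) : 0 <= s < 1 ->
  exists2 e, 0 < e & forall v, usphere v ->
    (e%:E <= P [set w | (enorm (X w) * s <= lin_proj v X w)%R])%E.
Proof.
move=> /andP[s0 s1].
have mcone := measurable_cone X Xrv.
suff : \forall e \near 0^'+, (@usphere R d) `<=` (fun v =>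
    e%:E <= P [set w | (enorm (X w) * s <= lin_proj v X w)%R])%E.
  move=> h; have [e [e0 he]] : exists e : R, 0 < e /\ (@usphere R d) `<=` (fun v =>
      e%:E <= P [set w | (enorm (X w) * s <= lin_proj v X w)%R])%E.
    near (0:R)^'+ => e; exists e; split; first by [].
    by near: e.
  by exists e.
(* Compactness as near covering: it suffices that each v0 has a neighbourhood where every small
   enough e > 0 works. *)
have /compact_near_coveringP/near_covering_withinP := @compact_usphere R d; apply.
(* r < 1 puts v0 in the interior of its cone, which therefore has positive mass, and r - s > 0
   absorbs the change from v0 to v. *)
move=> v0 sv0; pose r := (s + 1) / 2.
have r1 : r < 1 by rewrite /r; lra.
have sr : s < r by rewrite /r; lra.
have Ppos : (0 < P [set w | (enorm (X w) * r <= lin_proj v0 X w)%R])%E.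
  pose U := [set x : 'rV[R]_d | 0 < dot v0 x + (- r) * enorm x].
  apply: (@lt_le_trans _ _ (P (X @^-1` U))); last first.
    apply: le_probability => //.
      exact: (measurable_lt_rv X Xrv _ _ (continuous_dotD_enorm v0 _)).
    by move=> w; rewrite /U/= mulNr subr_gt0 mulrC => /ltW.
  apply: (probability_open_gt0 U v0); last first.
    by rewrite /U/= (usphere_dot _ sv0) sv0; lra.
  have /continuousP h := continuous_dotD_enorm v0 (- r).
  by apply: (h [set x | 0 < x]); exact: open_gt.
pose p := fine (P [set w | (enorm (X w) * r <= lin_proj v0 X w)%R]).
have pE : P [set w | (enorm (X w) * r <= lin_proj v0 X w)%R] = p%:E.
  by rewrite fineK// fin_num_measure.
have p0 : 0 < p by rewrite -lte_fin -pE.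
exists ([set v | forall w, `|lin_proj v X w - lin_proj v0 X w| <= (r - s) * enorm (X w)],
        [set e | e <= p]) => [|[v e] /= [vv0 ep] sv].
  by split; [apply: near_lin_proj; rewrite subr_gt0|exact: nbhs_right_le].
apply: (@le_trans _ _ p%:E); first by rewrite lee_fin.
rewrite -pE; apply: le_probability => // w /= rw.
by have := vv0 w; rewrite ler_distl => /andP[+ _]; lra.
Unshelve. all: by end_near. Qed.

End FullSupport.

Lemma usphere_nonempty {R : realType} {d : nat} : (0 < d)%N -> exists v : 'rV[R]_d, usphere v.
Proof.
case: d => // n _; pose x : 'rV[R]_n.+1 := const_mx 1.
exists ((enorm x)^-1 *: x); apply: usphere_normalize; apply/eqP => /rowP /(_ ord0) /eqP.
by rewrite !mxE oner_eq0.
Qed.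

(** * Bounds on [Mgamma], the signed gap on the sphere, and the theorem *)

Section Main.
Context {disp : measure_display} {T : measurableType disp} {R : realType}.
Variable P : probability T R.
Context {d : nat}.
Variable X : T -> 'rV[R]_d.
Hypothesis Xrv : random_vector X.
Hypothesis Xsupp : law_support P X = setT.

Lemma Mgamma_gt0_lt1 (gamma : R) : (0 < d)%N -> 0 < gamma < 1 ->
  0 < Mgamma P X gamma < 1.
Proof.
move=> d0 /andP[g0 g1]; rewrite /Mgamma.
have sq : 0 <= Num.sqrt (1 - gamma ^+ 2) < 1.
  rewrite sqrtr_ge0/= -[ltRHS]sqrtr1 ltr_sqrt// ltrBlDr ltrDl exprn_gt0//.
have [e e0 he] := cone_probability_bound P X Xrv Xsupp _ sq.
set I := ereal_inf _.
have Ie : (e%:E <= I)%E.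
  by apply: le_ereal_inf_tmp => _ [v sv <-]; exact: he.
have I1 : (I <= 1)%E.
  have [v sv] := @usphere_nonempty R d d0.
  apply: (@le_trans _ _
    (P [set w | (enorm (X w) * Num.sqrt (1 - gamma ^+ 2) <= lin_proj v X w)%R])).
    by apply: ereal_inf_lbound; exists v.
  by apply: probability_le1; exact: measurable_cone.
(* The infimum lies between e > 0 and 1, so [fine] returns its true value. *)
have If : I \is a fin_num.
  by rewrite fin_numElt (lt_le_trans (ltNyr _) Ie) (le_lt_trans I1 (ltry _)).
move: Ie I1; rewrite -(fineK If) !lee_fin => eI I1.
nra.
Qed.

Hypothesis Xcont : continuous_law P X.
Variable theta : 'rV[R]_d.
Variable b : R.
Hypothesis b01 : 0 < b < 1.

(** Real-valued and signed, unlike [quantile_gap], so that the intermediate value theorem applies to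
    it. *)
Let gap v := fine (quantile P (lin_proj v X) b) - dot v theta.

Lemma quantile_gapE v :
  quantile_gap P X theta b v = `|gap v|%:E.
Proof.
by rewrite /quantile_gap -[in LHS](fineK (quantile_fin_num P X Xrv v b b01)).
Qed.

Lemma near_gap (v0 : 'rV[R]_d) (e : R) : usphere v0 -> 0 < e ->
  \forall v \near v0, usphere v -> `|gap v0 - gap v| < e.
Proof.
move=> sv0 e0; have e2 : 0 < e / 2 by rewrite divr_gt0.
have h1 := near_quantile P X Xrv Xsupp b v0 (e / 2) Xcont b01 sv0 e2.
have h2 : \forall v \near v0, `|dot theta v0 - dot theta v| < e / 2.
  by have /cvgrPdist_lt := continuous_dotl theta v0; apply.
apply: filterS2 h1 h2 => v h1 h2 /h1.
rewrite /gap (dotC v0) (dotC v); move: h2.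
by rewrite ltr_norml ler_norml ltr_norml => /andP[? ?] /andP[? ?]; apply/andP; split; lra.
Qed.

Lemma quantile_gap_argmin : (0 < d)%N ->
  exists v0, is_argmin usphere (quantile_gap P X theta b) v0.
Proof.
move=> d0.
have [|v0 /set_mem sv0 min0] :=
  @EVT_min_rV R d (fun v => `|gap v|) usphere (usphere_nonempty d0) compact_usphere.
  apply/subspace_continuousP => v sv; apply: cvg_norm.
  by apply/cvgrPdist_lt => e e0; exact: near_gap.
by exists v0; split=> // v sv; rewrite !quantile_gapE lee_fin; apply: min0; rewrite inE.
Qed.

(* The survival probabilities of [u.X] and [-u.X] at [theta] add up to 1, so
   when [1 - b <= 1/2] the gap cannot be negative at both [u] and [-u]. *)
Lemma gapN_ge0 u : usphere u -> 2^-1 <= b -> gap u < 0 -> 0 <= gap (- u).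
Proof.
move=> su b2; rewrite /gap dotNl subr_lt0 opprK => gu.
have fq v := fineK (quantile_fin_num P X Xrv v b b01).
have : (quantile P (lin_proj u X) b < (dot u theta)%:E)%E by rewrite -fq lte_fin.
move=> /ereal_inf_lt [_ [t /= Pt <-]]; rewrite lte_fin => tu.
suff : ((- dot u theta)%:E <= quantile P (lin_proj (- u) X) b)%E.
  by rewrite -fq lee_fin; lra.
apply: quantile_ge => //.
have mt : measurable [set w | t < lin_proj u X w] by exact: measurable_lin_proj_gt.
have := probability_setC P mt.
have : P [set w | t < lin_proj u X w] \is a fin_num by exact: fin_num_measure.
move: Pt; case: (P [set w | t < lin_proj u X w]) => // p Pt _ PC.
apply: (@le_trans _ _ (P (~` [set w | t < lin_proj u X w]))).
  by rewrite PC -EFinB lee_fin; rewrite lte_fin in Pt; lra.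
apply: le_probability; [exact: measurableC|exact: measurable_lin_proj_gt|].
move=> w /= /negP; rewrite -leNgt /lin_proj dotNl ltrN2 => /le_lt_trans; exact.
Qed.

Lemma exists_gap0 u : (2 <= d)%N -> usphere u -> 2^-1 <= b -> gap u < 0 ->
  exists2 v, usphere v & gap v = 0.
Proof.
move=> d2 su b2 gu; have [w sw uw] := exists_orthonormal _ d2 su.
(* Half a great circle, from u at t = 0 to -u at t = pi. *)
pose phi (t : R) := cos t *: u + sin t *: w.
have sphi t : usphere (phi t).
  rewrite /usphere/= /enorm /phi !(dotDl, dotDr, dotZl, dotZr) (dotC w u) uw.
  rewrite (usphere_dot _ su) (usphere_dot _ sw) !(mulr0, mulr1, addr0, add0r) -!expr2.
  by rewrite cos2Dsin2 sqrtr1.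
have cphi : continuous phi.
  move=> t; apply: cvgD; apply: cvgZr_tmp; [exact: continuous_cos|exact: continuous_sin].
have [|||t _ gt] := @IVT R (gap \o phi) 0 pi 0.
- exact: pi_ge0.
- apply: continuous_subspaceT => t; apply/cvgrPdist_lt => e e0.
  have h : \forall s \near t, usphere (phi s) -> `|gap (phi t) - gap (phi s)| < e.
    exact: (cphi t _ (near_gap _ _ (sphi t) e0)).
  by apply: filterS h => s /(_ (sphi s)).
- rewrite /= /phi cos0 sin0 cospi sinpi !scale0r !addr0 scale1r scaleN1r.
  have gNu := gapN_ge0 _ su b2 gu.
  by rewrite ge_min (ltW gu) le_max gNu orbT.
by exists (phi t).
Qed.

End Main.

Theorem theorem3p7 (R : realType) (d : nat) (hd : (2 <= d)%N)
  (disp : measure_display) (T : measurableType disp) (P : probability T R)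
  (X : T -> 'rV[R]_d)
  (Xrv : random_vector X)
  (Xcont : continuous_law P X)
  (Xsupp : law_support P X = setT)
  (theta : 'rV[R]_d)
  (htheta : is_argmax setT (HD P X) theta)
  (gamma : R) (hgamma : 0 < gamma < 1) :
  0 < Mgamma P X gamma < 1 /\
  forall alpha : R, 0 < alpha < 1 ->
    1 - Mgamma P X gamma / (d.+1)%:R < alpha ^+ 2 < 1 ->
    exists v0 : 'rV[R]_d,
      is_argmin (usphere)
        (quantile_gap P X theta (1 - (1 - alpha ^+ 2) / Mgamma P X gamma)) v0 /\
      forall u q : 'rV[R]_d, usphere u ->
        is_geometric_quantile P X (alpha *: u) q ->
        (quantile_gap P X theta (1 - (1 - alpha ^+ 2) / Mgamma P X gamma) v0
           <= (enorm (q - theta))%:E)%E.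
Proof.
have d0 : (0 < d)%N by exact: ltnW.
have M01 := Mgamma_gt0_lt1 P X Xrv Xsupp gamma d0 hgamma.
split=> // alpha /andP[a0 a1] /andP[Ma a21].
move: M01 Ma; set M := Mgamma P X gamma => /andP[M0 M1] Ma.
set b := 1 - _.
have c0 : 0 < (1 - alpha ^+ 2) / M by rewrite divr_gt0// subr_gt0.
(* 1 - alpha^2 < M / (d + 1) <= M / 2, since d + 1 >= 2. *)
have c2 : (1 - alpha ^+ 2) / M < 2^-1.
  rewrite ltr_pdivrMr//.
  have : M / d.+1%:R <= M / 2.
    by rewrite ler_pM2l// lef_pV2 ?posrE// ler_nat; exact: ltnW.
  by move: Ma; set k := M / _ => ? ?; lra.
(* (1 - alpha) M < 1 - alpha < (1 - alpha) (1 + alpha), because M < 1 and alpha > 0. *)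
have ac : 1 - alpha < (1 - alpha ^+ 2) / M by rewrite ltr_pdivlMr//; nra.
have b01 : 0 < b < 1 by rewrite /b; lra.
have [v0 minv0] := quantile_gap_argmin P X Xrv Xsupp Xcont theta b b01 d0.
exists v0; split=> // u q su hq.
have [_ minv] := minv0.
have qu : fine (quantile P (lin_proj u X) b) <= dot u q.
  (* The tail bound holds only beyond u.q + t with t > 0, so t is sent to 0. *)
  apply/ler_addgt0Pr => t t0.
  rewrite -lee_fin fineK ?quantile_fin_num//; apply: quantile_le.
  apply: le_lt_trans (survival_geometric_quantile_le P X Xrv u q alpha t su hq t0) _.
  by rewrite lte_fin /b; lra.
have [gu|gu] := leP 0 (fine (quantile P (lin_proj u X) b) - dot u theta).
  apply: (le_trans (minv u su)); rewrite quantile_gapE// lee_fin ger0_norm//.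
  apply: (@le_trans _ _ (dot u (q - theta))); first by rewrite dotDr dotNr lerB.
  by apply: (le_trans (cauchy_schwarz _ _)); rewrite su mul1r.
have [|v sv gv] := exists_gap0 P X Xrv Xsupp Xcont theta b b01 u hd su _ gu.
  by rewrite /b; lra.
apply: (le_trans (minv v sv)).
by rewrite quantile_gapE// gv normr0 lee_fin enorm_ge0.
Qed.
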